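(* Let $A$ be a Banach $D$-module and let $B$ be a free finite-dimensional associative Banach $D$-algebra with basis $(e_i)$ as a $D$-module. Let $(F_k)$ be a (finite) basis of the left $B\otimes B$-module $\mathcal{L}(D;B\to B)$, and let $G:A\to B$ be a $D$-linear map of maximal rank. Let $g:A\to\mathcal{L}(D;A\to B)$ be a differentiable map such that $\ker G\subseteq\ker g(x)$ for every $x\in A$, written with differentiable standard components $g^{k\cdot ij}:A\to D$, i.e. $$g(x)\circ h=\sum_{k,i,j} g^{k\cdot ij}(x)\,e_i\,\bigl(F_k\circ G\circ h\bigr)\,e_j\qquad (x,h\in A).$$ Then the differential equation $$\frac{dy}{dx}=\sum_{k,i,j}g^{k\cdot ij}(x)\,(e_i\otimes e_j)\circ F_k\circ G$$ is integrable if and only if for all $x,h_1,h_2\in A$ $$\sum_{k,i,j}\Bigl(\frac{dg^{k\cdot ij}(x)}{dx}\circ h_2\Bigr)\,e_i\,(F_k\circ G\circ h_1)\,e_j=\sum_{k,i,j}\Bigl(\frac{dg^{k\cdot ij}(x)}{dx}\circ h_1\Bigr)\,e_i\,(F_k\circ G\circ h_2)\,e_j .$$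
   Context: $D$ is a complete commutative (normed) ring of characteristic $0$; real scalars act on $D$-modules (derivatives are computed with real increments $t\to 0$). $\mathcal{L}(D;A\to B)$ is the $D$-module of (continuous) $D$-linear maps $A\to B$; $f\circ h$ denotes the value of the linear map $f$ at $h$. $\mathcal{L}(D;B\to B)$ is a left $B\otimes B$-module via $((b_1\otimes b_2)\circ f)(x)=b_1f(x)b_2$. The derivative $\frac{df(x)}{dx}\in\mathcal{L}(D;A\to B)$ of $f:A\to B$ is the linear map with $f(x+h)-f(x)=\frac{df(x)}{dx}\circ h+o(h)$. The differential equation $\frac{dy}{dx}=g(x)$ is called integrable if there exists a map $f:A\to B$ with $\frac{df(x)}{dx}=g(x)$ for all $x\in A$. *)

(* Defs.v *)
(* World: Stdlib reals with Coquelicot. *)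
From Stdlib Require Import Reals.
From Coquelicot Require Import Coquelicot.

Set Implicit Arguments.
Unset Strict Implicit.
Open Scope R_scope.

(* Conventions.
   - Coquelicot's [AbsRing] is a ring with a submultiplicative norm, and
     [CompleteNormedModule D] is a Banach D-module.
   - [is_linear] means D-linear and bounded, i.e. membership in L(D; U -> V),
     and [filterdiff f (locally x) l] says that l lies in L(D; U -> V) and
     f (x + h) - f x = l h + o(h).
   - Finite families are functions on [nat] of which only the indices
     1 .. n are used; all sums are [sum_n_m _ 1 n], which is zero if n = 0. *)

Definition in_range (n i : nat) : Prop := (1 <= i <= n)%nat.

Definition complete_space (T : UniformSpace) : Prop :=
  forall F : (T -> Prop) -> Prop,
    ProperFilter F -> cauchy F -> exists x : T, filter_le F (locally x).

(* [iota] is the action of the real scalars: an embedding of the normed field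
   R into D.  Since D acts on its modules, t : R acts as [scal (iota t)].  The
   embedding is required to be isometric, as for any normed R-algebra in which
   the norm of the unit is 1 (which holds in every [AbsRing]). *)
Record complete_real_ring (D : AbsRing) (iota : R -> D) : Prop := {
  crr_comm : forall a b : D, mult a b = mult b a;
  crr_complete : complete_space (AbsRing_UniformSpace D);
  crr_char0 : forall n : nat, (0 < n)%nat ->
    sum_n_m (fun _ => one : D) 1 n <> zero;
  crr_plus : forall s t : R, iota (s + t) = plus (iota s) (iota t);
  crr_mult : forall s t : R, iota (s * t) = mult (iota s) (iota t);
  crr_one : iota 1 = one;
  crr_abs : forall t : R, abs (iota t) = Rabs t
}.

(* Associative product making the Banach module B a Banach D-algebra; a unit
   is not required. *)
Record banach_algebra (D : AbsRing) (B : CompleteNormedModule D)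
    (mul : B -> B -> B) : Prop := {
  alg_plus_l : forall a b c : B, mul (plus a b) c = plus (mul a c) (mul b c);
  alg_plus_r : forall a b c : B, mul a (plus b c) = plus (mul a b) (mul a c);
  alg_scal_l : forall (d : D) (a b : B), mul (scal d a) b = scal d (mul a b);
  alg_scal_r : forall (d : D) (a b : B), mul a (scal d b) = scal d (mul a b);
  alg_assoc : forall a b c : B, mul a (mul b c) = mul (mul a b) c;
  alg_norm : forall a b : B, norm (mul a b) <= norm a * norm b
}.

Section Modules.

Context {D : AbsRing}.

Definition lin_indep {V : CompleteNormedModule D} (n : nat) (v : nat -> V)
    : Prop :=
  forall c : nat -> D,
    sum_n_m (fun i => scal (c i) (v i)) 1 n = zero ->
    forall i, in_range n i -> c i = zero.

Definition is_basis {V : CompleteNormedModule D} (n : nat) (v : nat -> V)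
    : Prop :=
  (forall x : V, exists c : nat -> D,
     x = sum_n_m (fun i => scal (c i) (v i)) 1 n) /\
  lin_indep n v.

Definition rank_ge {A B : CompleteNormedModule D} (G : A -> B) (r : nat)
    : Prop :=
  exists a : nat -> A, lin_indep r (fun i => G (a i)).

Definition maximal_rank {A B : CompleteNormedModule D} (G : A -> B) : Prop :=
  forall G' : A -> B, is_linear G' ->
    forall r : nat, rank_ge G' r -> rank_ge G r.

Section Tensor.

Context {B : CompleteNormedModule D}.
Variable mul : B -> B -> B.

(* (b1 (x) b2) o f *)
Definition tensor_act (b1 b2 : B) (f : B -> B) : B -> B :=
  fun x => mul (mul b1 (f x)) b2.

(* The left B(x)B-submodule of L(D; B -> B) generated by the F k, I k.  As
   B(x)B is additively generated by the pure tensors, closure under the D-module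
   operations and  the action of pure tensors suffices. *)
Inductive tensor_span (I : nat -> Prop) (F : nat -> B -> B)
    : (B -> B) -> Prop :=
| ts_zero : tensor_span I F (fun _ => zero)
| ts_gen : forall k, I k -> tensor_span I F (F k)
| ts_plus : forall f g, tensor_span I F f -> tensor_span I F g ->
    tensor_span I F (fun x => plus (f x) (g x))
| ts_scal : forall (d : D) f, tensor_span I F f ->
    tensor_span I F (fun x => scal d (f x))
| ts_act : forall b1 b2 f, tensor_span I F f ->
    tensor_span I F (tensor_act b1 b2 f)
| ts_ext : forall f g, tensor_span I F f -> (forall x, f x = g x) ->
    tensor_span I F g.

Definition tensor_generates (I : nat -> Prop) (F : nat -> B -> B) : Prop :=
  forall f : B -> B, is_linear f -> tensor_span I F f.

(* Basis of the left B(x)B-module L(D; B -> B), in the sense of a minimal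
   generating family.  L(D; B -> B) need not be free over B(x)B: for D = R and
   B = C the basis is {id, conjugation}, although 1(x)1 + i(x)i annihilates id.
   Since B has finite rank over D, freeness would moreover force the family to
   have a single element.  For unital B <> 0, a B(x)B-linearly independent generating
   family is minimal, so it is an instance of this definition. *)
Definition tensor_basis (m : nat) (F : nat -> B -> B) : Prop :=
  (forall k, in_range m k -> is_linear (F k)) /\
  tensor_generates (in_range m) F /\
  (forall k0, in_range m k0 ->
     ~ tensor_generates (fun k => in_range m k /\ k <> k0) F).

(* sum_{k,i,j} c^{k.ij} ((e_i (x) e_j) o F_k) applied to b *)
Definition std_expansion (n m : nat) (e : nat -> B) (F : nat -> B -> B)
    (c : nat -> nat -> nat -> D) (b : B) : B :=
  sum_n_m (fun k =>
    sum_n_m (fun i =>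
      sum_n_m (fun j =>
        scal (c k i j) (tensor_act (e i) (e j) (F k) b)) 1 n) 1 n) 1 m.

End Tensor.

Section Calculus.

Context {A B : CompleteNormedModule D}.

Definition opnorm_le (l : A -> B) (M : R) : Prop :=
  forall v : A, norm (l v) <= M * norm v.

(* dg is the derivative at x of g : A -> L(D; A -> B), the target carrying the
   operator norm: dg lies in L(D; A -> L(D; A -> B)) and
   g y - g x - dg (y - x) = o(y - x). *)
Definition op_derivative (g : A -> A -> B) (x : A) (dg : A -> A -> B)
    : Prop :=
  (forall h, is_linear (dg h)) /\
  (forall h1 h2 v, dg (plus h1 h2) v = plus (dg h1 v) (dg h2 v)) /\
  (forall (d : D) h v, dg (scal d h) v = scal d (dg h v)) /\
  (exists M : R, 0 < M /\ forall h, opnorm_le (dg h) (M * norm h)) /\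
  (forall eps : posreal, locally x (fun y =>
     opnorm_le
       (fun v => minus (minus (g y v) (g x v)) (dg (minus y x) v))
       (eps * norm (minus y x)))).

Definition op_differentiable (g : A -> A -> B) : Prop :=
  forall x : A, exists dg : A -> A -> B, op_derivative g x dg.

Definition integrable (w : A -> A -> B) : Prop :=
  exists f : A -> B, forall x : A, filterdiff f (locally x) (w x).

End Calculus.

End Modules.

(* Main.v *)
Require Import Defs.
From Stdlib Require Import Reals Lra Lia List FunctionalExtensionality.
From Coquelicot Require Import Coquelicot.

(* The equation is dy/dx = g(x) for a differentiable g : A -> L(D; A -> B), and
   the condition says that the bilinear maps dg(x) are symmetric.  Restricting
   scalars along [iota] turns A and B into real Banach spaces, where this is
   Poincare's lemma.  Both directions rest on one estimate: on a small triangle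
   x, x + u, x + v the circulation of g is (dg(x)(u, v) - dg(x)(v, u)) / 2 up to
   o(size^2).  If g is the derivative of f, the circulation vanishes, and scaling
   u and v to 0 gives the symmetry.  Conversely, dg need not be continuous, so
   Goursat's subdivision argument is used to see that symmetry forces every
   circulation to vanish; then f(x), the integral of g along the segment from 0
   to x, is a primitive. *)

Open Scope R_scope.

(** * Restriction of scalars *)

Section RestrictScalars.

Variables (D : AbsRing) (iota : R -> D).
Hypothesis hD : complete_real_ring iota.
Variable V : CompleteNormedModule D.

Definition real_scal (t : R) (x : V) : V := scal (iota t) x.

Lemma real_scal_assoc (s t : R) (x : V) :
  real_scal s (real_scal t x) = real_scal (s * t) x.
Proof. unfold real_scal; rewrite (crr_mult hD); apply scal_assoc. Qed.

Lemma real_scal_one (x : V) : real_scal 1 x = x.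
Proof. unfold real_scal; rewrite (crr_one hD); apply (scal_one x). Qed.

Lemma real_scal_distr_l (t : R) (x y : V) :
  real_scal t (plus x y) = plus (real_scal t x) (real_scal t y).
Proof. apply (scal_distr_l (iota t) x y). Qed.

Lemma real_scal_distr_r (s t : R) (x : V) :
  real_scal (s + t) x = plus (real_scal s x) (real_scal t x).
Proof. unfold real_scal; rewrite (crr_plus hD); apply (scal_distr_r _ _ x). Qed.

Lemma norm_real_scal (t : R) (x : V) :
  norm (real_scal t x) <= Rabs t * norm x.
Proof.
  unfold real_scal; rewrite <- (crr_abs hD); apply (norm_scal (iota t) x).
Qed.

Definition restrict_ModuleSpace_mixin : ModuleSpace.mixin_of R_Ring V :=
  ModuleSpace.Mixin R_Ring V real_scal
    real_scal_assoc real_scal_one real_scal_distr_l real_scal_distr_r.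

Definition restrict_NormedModuleAux : NormedModuleAux R_AbsRing :=
  NormedModuleAux.Pack R_AbsRing V
    (NormedModuleAux.Class R_AbsRing V
      (ModuleSpace.Class R_Ring V _ restrict_ModuleSpace_mixin)
      (UniformSpace.class V)) V.

Definition restrict_NormedModule_mixin :
    NormedModule.mixin_of R_AbsRing restrict_NormedModuleAux :=
  NormedModule.Mixin R_AbsRing restrict_NormedModuleAux
    (norm (V := V)) (norm_factor (V := V))
    norm_triangle norm_real_scal norm_compat1 norm_compat2 norm_eq_zero.

Definition restrict_scalars : CompleteNormedModule R_AbsRing :=
  CompleteNormedModule.Pack R_AbsRing V
    (CompleteNormedModule.Class R_AbsRing V
      (NormedModule.Class R_AbsRing V _ restrict_NormedModule_mixin)
      (CompleteSpace.mixin _ (CompleteSpace.class V))) V.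

End RestrictScalars.

(** * Linear identities in real modules *)

Inductive mexpr :=
  | MVar (i : nat)
  | MZero
  | MPlus (a b : mexpr)
  | MOpp (a : mexpr)
  | MScal (t : R) (a : mexpr).

Fixpoint mcoef (e : mexpr) (i : nat) : R :=
  match e with
  | MVar j => if Nat.eqb j i then 1 else 0
  | MZero => 0
  | MPlus a b => mcoef a i + mcoef b i
  | MOpp a => - mcoef a i
  | MScal t a => t * mcoef a i
  end.

Fixpoint same_coefs (n : nat) (a b : mexpr) : Prop :=
  match n with
  | O => True
  | S n' => mcoef a n' = mcoef b n' /\ same_coefs n' a b
  end.

Section ModuleReflection.

Context {V : ModuleSpace R_AbsRing}.

Fixpoint meval (env : list V) (e : mexpr) : V :=
  match e with
  | MVar i => nth i env zero
  | MZero => zero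
  | MPlus a b => plus (meval env a) (meval env b)
  | MOpp a => opp (meval env a)
  | MScal t a => scal t (meval env a)
  end.

(* The index [length env] is included so that the range is never empty; its
   term is the default [zero]. *)
Definition lincomb (env : list V) (c : nat -> R) : V :=
  sum_n_m (fun i => scal (c i : R_AbsRing) (nth i env zero)) 0 (length env).

Lemma sum_n_m_eq_zero (f : nat -> V) (a b : nat) :
  (forall i, (a <= i <= b)%nat -> f i = zero) -> sum_n_m f a b = zero.
Proof.
  intros H; rewrite (sum_n_m_ext_loc f (fun _ => zero)) by exact H.
  apply sum_n_m_const_zero.
Qed.

Lemma meval_lincomb (env : list V) (e : mexpr) :
  meval env e = lincomb env (mcoef e).
Proof.
  unfold lincomb; induction e as [j| |a IHa b IHb|a IHa|t a IHa]; simpl.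
  - assert (Hother : forall i, i <> j ->
      scal ((if Nat.eqb j i then 1 else 0) : R_AbsRing) (nth i env zero) =
      zero).
    { intros i Hi; destruct (Nat.eqb_spec j i) as [Heq|_];
        [congruence | apply @scal_zero_l]. }
    destruct (Nat.le_gt_cases (length env) j) as [Hj|Hj].
    + rewrite nth_overflow by exact Hj.
      symmetry; apply sum_n_m_eq_zero; intros i Hi.
      destruct (Nat.eq_dec i j) as [->|Hij]; [|apply Hother, Hij].
      rewrite nth_overflow by exact Hj; apply @scal_zero_r.
    + rewrite (sum_n_m_Chasles _ 0 j) by lia.
      rewrite (sum_n_m_eq_zero _ (S j)) by (intros i Hi; apply Hother; lia).
      rewrite plus_zero_r.
      destruct j as [|j'].
      * rewrite sum_n_n; simpl; symmetry; apply @scal_one.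
      * rewrite sum_n_Sm by lia.
        rewrite (sum_n_m_eq_zero _ 0%nat j')
          by (intros i Hi; apply Hother; lia).
        rewrite plus_zero_l, Nat.eqb_refl; symmetry; apply @scal_one.
  - symmetry; apply sum_n_m_eq_zero; intros i _; apply @scal_zero_l.
  - rewrite IHa, IHb, <- sum_n_m_plus.
    apply sum_n_m_ext_loc; intros i _; symmetry; apply @scal_distr_r.
  - rewrite IHa, <- (@scal_opp_one R_AbsRing V),
      <- (sum_n_m_scal_l (K := R_AbsRing)).
    apply sum_n_m_ext_loc; intros i _; rewrite scal_assoc.
    f_equal; unfold mult, opp, one; simpl; ring.
  - rewrite IHa, <- (sum_n_m_scal_l (K := R_AbsRing)).
    apply sum_n_m_ext_loc; intros i _; apply @scal_assoc.
Qed.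

Lemma meval_eq (env : list V) (a b : mexpr) :
  same_coefs (S (length env)) a b -> meval env a = meval env b.
Proof.
  intros H; rewrite !meval_lincomb.
  apply sum_n_m_ext_loc; intros i [_ Hi]; f_equal.
  assert (Hlt : (i < S (length env))%nat) by lia; clear Hi.
  revert H Hlt; generalize (S (length env)) as k.
  induction k as [|k IHk]; intros H Hlt; [lia|].
  destruct H as [H1 H2]; destruct (Nat.eq_dec i k) as [->|Hik];
    [exact H1 | apply IHk; [exact H2 | lia]].
Qed.

End ModuleReflection.

Ltac mindex x env :=
  lazymatch env with
  | cons ?y ?env' =>
      match constr:(Set) with
      | _ => let _ := match constr:(Set) with _ => unify x y end in
             constr:(O)
      | _ => let i := mindex x env' in constr:(S i)
      end
  end.

Ltac madd x env :=
  match constr:(Set) with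
  | _ => let _ := mindex x env in env
  | _ => constr:(cons x env)
  end.

Ltac mcollect t env :=
  lazymatch t with
  | @plus _ ?a ?b => let env := mcollect a env in mcollect b env
  | @opp _ ?a => mcollect a env
  | @scal _ _ _ ?a => mcollect a env
  | @zero _ => env
  | _ => madd t env
  end.

Ltac mreify t env :=
  lazymatch t with
  | @plus _ ?a ?b =>
      let a := mreify a env in let b := mreify b env in constr:(MPlus a b)
  | @opp _ ?a => let a := mreify a env in constr:(MOpp a)
  | @scal _ _ ?s ?a => let a := mreify a env in constr:(MScal s a)
  | @zero _ => constr:(MZero)
  | _ => let i := mindex t env in constr:(MVar i)
  end.

Ltac module_eq :=
  unfold minus;
  lazymatch goal with
  | |- @eq ?T ?a ?b =>
      let env := mcollect a (@nil T) in
      let env := mcollect b env in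
      let ea := mreify a env in
      let eb := mreify b env in
      refine (meval_eq env ea eb _);
      simpl; repeat split; field
  end.

(** * Poincare's lemma in real Banach spaces *)

Lemma locally_norm_iff {K : AbsRing} {V : NormedModule K} (x : V)
    (P : V -> Prop) :
  locally x P <->
  exists d : R, 0 < d /\ forall y, norm (minus y x) < d -> P y.
Proof.
  split.
  - intros H; destruct (locally_norm_le_locally x P H) as [d Hd].
    exists d; split; [apply cond_pos | exact Hd].
  - intros [d [Hd H]]; apply (locally_le_locally_norm x P).
    exists (mkposreal d Hd); exact H.
Qed.

Lemma norm_minus_triangle {K : AbsRing} {V : NormedModule K} (x y : V) :
  norm (minus x y) <= norm x + norm y.
Proof. unfold minus; rewrite <- (norm_opp y); apply norm_triangle. Qed.

Lemma norm_minus_self {K : AbsRing} {V : NormedModule K} (x : V) :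
  norm (minus x x) = 0.
Proof. rewrite minus_eq_zero; apply norm_zero. Qed.

Lemma norm_minus_sym {K : AbsRing} {V : NormedModule K} (x y : V) :
  norm (minus x y) = norm (minus y x).
Proof. rewrite <- (norm_opp (minus y x)), opp_minus; reflexivity. Qed.

Lemma norm_minus_trans {K : AbsRing} {V : NormedModule K} (x y z : V) :
  norm (minus x z) <= norm (minus x y) + norm (minus y z).
Proof. rewrite (minus_trans y x z); apply norm_triangle. Qed.

Lemma le_0_of_le_mult_eps (x C : R) :
  (forall eps, 0 < eps -> x <= eps * C) -> x <= 0.
Proof.
  intros H; destruct (Rle_or_lt x 0) as [Hx|Hx]; [exact Hx|].
  pose proof (H 1 Rlt_0_1) as HC.
  specialize (H (x / (2 * C)) ltac:(apply Rdiv_lt_0_compat; lra)).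
  replace (x / (2 * C) * C) with (x / 2) in H by (field; lra); lra.
Qed.

Lemma norm_le_0_eq {K : AbsRing} {V : NormedModule K} (x : V) :
  norm x <= 0 -> x = zero.
Proof.
  intros H; apply norm_eq_zero, Rle_antisym; [exact H | apply norm_ge_0].
Qed.

Lemma minus_eq_of_plus {V : CompleteNormedModule R_AbsRing} (x y z : V) :
  minus (plus x y) z = zero -> minus z x = y.
Proof.
  intros H; transitivity (minus y (minus (plus x y) z)); [module_eq|].
  rewrite H; module_eq.
Qed.

Lemma norm_real_scal_le {V : NormedModule R_AbsRing} (t : R) (x : V) :
  norm (scal t x) <= Rabs t * norm x.
Proof. apply (norm_scal t x). Qed.

(* Norms of the same vector reached through different coercion paths are
   convertible but not syntactically equal, which [lra] and [nra] require. *)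
Ltac generalize_norms :=
  repeat match goal with
  | H : context [@norm ?K ?V ?x] |- _ => generalize_norm K V x
  | |- context [@norm ?K ?V ?x] => generalize_norm K V x
  end
with generalize_norm K V x :=
  let r := fresh "r" in
  pose (r := @norm K V x);
  assert (0 <= r) by exact (norm_ge_0 x);
  repeat match goal with
  | H : context [@norm ?K' ?V' ?x'] |- _ =>
      change (@norm K' V' x') with r in H
  | |- context [@norm ?K' ?V' ?x'] => change (@norm K' V' x') with r
  end;
  clearbody r.

Section Poincare.

Context {A B : CompleteNormedModule R_AbsRing}.
Variables (g : A -> A -> B) (dg : A -> A -> A -> B).
Hypothesis g_linear : forall x, is_linear (g x).
Hypothesis g_derivative : forall x, op_derivative g x (dg x).

Definition remainder_le (x : A) (eps d : R) : Prop :=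
  forall y v : A, norm (minus y x) < d ->
    norm (minus (minus (g y v) (g x v)) (dg x (minus y x) v)) <=
    eps * norm (minus y x) * norm v.

Lemma derivative_remainder (x : A) (eps : R) :
  0 < eps -> exists d, 0 < d /\ remainder_le x eps d.
Proof.
  intros Heps.
  destruct (g_derivative x) as [_ [_ [_ [_ H]]]].
  destruct (proj1 (locally_norm_iff x _) (H (mkposreal eps Heps)))
    as [d [Hd Hy]].
  exists d; split; [exact Hd | intros y v Hyd; exact (Hy y Hyd v)].
Qed.

Lemma dg_plus_l (x h1 h2 v : A) :
  dg x (plus h1 h2) v = plus (dg x h1 v) (dg x h2 v).
Proof. apply (g_derivative x). Qed.

Lemma dg_scal_l (x : A) (t : R) (h v : A) :
  dg x (scal t h) v = scal t (dg x h v).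
Proof. apply (g_derivative x). Qed.

Lemma dg_zero_l (x v : A) : dg x zero v = zero.
Proof.
  transitivity (dg x (scal 0 zero) v); [f_equal; module_eq|].
  rewrite dg_scal_l; module_eq.
Qed.

Lemma dg_linear (x h : A) : is_linear (dg x h).
Proof. apply (g_derivative x). Qed.

Lemma dg_opp_l (x h v : A) : dg x (opp h) v = opp (dg x h v).
Proof.
  replace (opp h) with (scal (-1) h) by module_eq.
  rewrite dg_scal_l; module_eq.
Qed.

Lemma dg_bounded (x : A) :
  exists M, 0 < M /\ forall h v : A, norm (dg x h v) <= M * norm h * norm v.
Proof.
  destruct (g_derivative x) as [_ [_ [_ [[M [HM H]] _]]]].
  exists M; split; [exact HM | intros h v; apply H].
Qed.

Lemma locally_lipschitz (x : A) :
  exists d M, 0 < d /\ 0 < M /\ forall y v : A, norm (minus y x) < d ->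
    norm (minus (g y v) (g x v)) <= M * norm (minus y x) * norm v.
Proof.
  destruct (derivative_remainder x 1 Rlt_0_1) as [d [Hd Hr]].
  destruct (dg_bounded x) as [M [HM Hb]].
  exists d, (1 + M); repeat split; [lra | lra |].
  intros y v Hy; specialize (Hr y v Hy); specialize (Hb (minus y x) v).
  replace (minus (g y v) (g x v)) with
    (plus (minus (minus (g y v) (g x v)) (dg x (minus y x) v))
       (dg x (minus y x) v)) by module_eq.
  eapply Rle_trans; [apply (norm_triangle (V := B)) | lra].
Qed.

Lemma continuous_apply (h x : A) : continuous (fun y => g y h) x.
Proof.
  destruct (locally_lipschitz x) as [d [M [Hd [HM H]]]].
  apply filterlim_locally; intros eps.
  apply (proj2 (locally_norm_iff (V := A) x _)).
  pose proof (norm_ge_0 h) as Hh.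
  pose proof (cond_pos eps) as He.
  assert (Hq : 0 < eps / (M * norm h + 1)).
  { apply Rdiv_lt_0_compat; [exact He | nra]. }
  exists (Rmin d (eps / (M * norm h + 1))); split; [now apply Rmin_glb_lt|].
  intros y Hy; apply (norm_compat1 (V := B)).
  eapply Rle_lt_trans;
    [apply H, (Rlt_le_trans _ _ _ Hy), Rmin_l|].
  assert (Hy2 := Rlt_le_trans _ _ _ Hy (Rmin_r _ _)).
  apply Rlt_div_r in Hy2; [|nra].
  generalize_norms; nra.
Qed.

Definition segment (a h : A) (t : R) : B := g (plus a (scal t h)) h.

Definition segment_integral (a h : A) : B := RInt (segment a h) 0 1.

Lemma continuous_segment (a h : A) (t : R) : continuous (segment a h) t.
Proof.
  apply (continuous_comp (fun t : R => plus a (scal t h)) (fun y => g y h)).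
  - apply (continuous_plus (V := A) (fun _ : R => a)); [apply continuous_const|].
    apply (continuous_scal_l (K := R_AbsRing) (V := A) (fun t : R => t) h t).
    apply continuous_id.
  - apply continuous_apply.
Qed.

Lemma is_RInt_segment (a h : A) :
  is_RInt (segment a h) 0 1 (segment_integral a h).
Proof.
  apply RInt_correct, (ex_RInt_continuous (V := B)).
  intros t _; apply continuous_segment.
Qed.

Lemma is_RInt_subsegment (a h : A) (u v : R) :
  is_RInt (segment a h) v (u + v)
    (segment_integral (plus a (scal v h)) (scal u h)).
Proof.
  assert (Hex : ex_RInt (segment a h) v (u + v)).
  { apply (ex_RInt_continuous (V := B)); intros t _.
    apply continuous_segment. }
  destruct Hex as [l Hl].
  replace (segment_integral _ _) with l; [exact Hl|].
  symmetry; apply is_RInt_unique.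
  apply (is_RInt_ext (fun t => scal u (segment a h (u * t + v)))).
  - intros t _; unfold segment.
    rewrite <- (linear_scal _ (g_linear _)).
    f_equal; module_eq.
  - apply (is_RInt_comp_lin (V := B) (segment a h) u v 0 1).
    replace (u * 0 + v) with v by ring.
    replace (u * 1 + v) with (u + v) by ring.
    exact Hl.
Qed.

Lemma segment_integral_halve (a h : A) :
  segment_integral a h =
  plus (segment_integral a (scal (1 / 2) h))
    (segment_integral (plus a (scal (1 / 2) h)) (scal (1 / 2) h)).
Proof.
  pose proof (is_RInt_subsegment a h (1 / 2) 0) as H1.
  pose proof (is_RInt_subsegment a h (1 / 2) (1 / 2)) as H2.
  replace (1 / 2 + 0) with (1 / 2) in H1 by field.
  replace (1 / 2 + 1 / 2) with 1 in H2 by field.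
  replace (plus a (scal 0 h)) with a in H1 by module_eq.
  apply is_RInt_unique, (is_RInt_Chasles _ _ _ _ _ _ H1 H2).
Qed.

Lemma segment_integral_reverse (a h b k : A) :
  b = plus a h -> k = opp h ->
  segment_integral b k = opp (segment_integral a h).
Proof.
  intros -> ->.
  pose proof (is_RInt_subsegment a h (-1) 1) as H.
  replace (-1 + 1) with 0 in H by ring.
  apply is_RInt_swap in H.
  replace (plus a (scal 1 h)) with (plus a h) in H by module_eq.
  replace (scal (-1) h) with (opp h) in H by module_eq.
  unfold segment_integral at 2; rewrite (is_RInt_unique _ _ _ _ H).
  module_eq.
Qed.

(* The integral of [g] around the triangle [p], [p + u], [p + v]. *)
Definition triangle_integral (p u v : A) : B :=
  minus
    (plus (segment_integral p u)
       (segment_integral (plus p u) (minus v u)))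
    (segment_integral p v).

Lemma triangle_integral_split (p u v : A) :
  let u' := scal (1 / 2) u in
  let v' := scal (1 / 2) v in
  triangle_integral p u v =
  plus (plus (triangle_integral p u' v')
          (triangle_integral (plus p u') u' v'))
    (plus (triangle_integral (plus p v') u' v')
       (triangle_integral (plus p (plus u' v')) (opp u') (opp v'))).
Proof.
  intros u' v'; unfold triangle_integral.
  rewrite (segment_integral_halve p u), (segment_integral_halve p v).
  rewrite (segment_integral_halve (plus p u) (minus v u)).
  fold u' v'.
  replace (scal (1 / 2) (minus v u)) with (minus v' u')
    by (unfold u', v'; module_eq).
  replace (plus (plus p u') u') with (plus p u) by (unfold u'; module_eq).
  replace (plus (plus p u) (minus v' u')) with (plus p (plus u' v'))
    by (unfold u'; module_eq).
  replace (plus (plus p v') u') with (plus p (plus u' v')) by module_eq.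
  rewrite (segment_integral_reverse (plus p v') u' _ (opp u'))
    by module_eq.
  rewrite (segment_integral_reverse (plus p u') v' _ (opp v'))
    by module_eq.
  rewrite (segment_integral_reverse (plus p u') (minus v' u') _
    (minus (opp v') (opp u'))) by module_eq.
  clearbody u' v'. module_eq.
Qed.

Lemma is_RInt_affine (c0 c1 : B) :
  is_RInt (fun t => plus c0 (scal t c1)) 0 1 (plus c0 (scal (1 / 2) c1)).
Proof.
  assert (H0 : is_RInt (V := B) (fun _ => c0) 0 1 c0).
  { refine (eq_ind _ (is_RInt (fun _ => c0) 0 1)
      (is_RInt_const (V := B) 0 1 c0) c0 _); module_eq. }
  apply (is_RInt_plus (V := B) _ _ _ _ _ _ H0).
  replace (scal (1 / 2) c1) with
    (minus (scal (1 * 1 / 2) c1) (scal (0 * 0 / 2) c1)) by module_eq.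
  apply (is_RInt_derive (V := B) (fun t : R => scal (t * t / 2) c1)
    (fun t : R => scal t c1)).
  - intros t _.
    apply (is_derive_scal_l (V := B) (fun t : R => t * t / 2) t t c1).
    auto_derive; [exact I | field].
  - intros t _.
    apply (continuous_scal_l (K := R_AbsRing) (V := B) (fun t : R => t) c1 t).
    apply continuous_id.
Qed.

Lemma segment_integral_estimate (x : A) (eps d K : R) (a h : A) :
  0 <= eps -> remainder_le x eps d -> K < d ->
  (forall t, 0 <= t <= 1 -> norm (minus (plus a (scal t h)) x) <= K) ->
  norm (minus (segment_integral a h)
          (plus (plus (g x h) (dg x (minus a x) h))
             (scal (1 / 2) (dg x h h)))) <= eps * K * norm h.
Proof.
  intros Heps Hr HK Ht.
  replace (eps * K * norm h) with ((1 - 0) * (eps * K * norm h)) by ring.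
  refine (norm_RInt_le_const _ 0 1 _ _ Rle_0_1 _
    (is_RInt_minus _ _ _ _ _ _ (is_RInt_segment a h) (is_RInt_affine _ _))).
  intros t H01; specialize (Ht t H01).
  assert (Hd := Hr _ h (Rle_lt_trans _ _ _ Ht HK)).
  replace (minus (plus a (scal t h)) x) with (plus (minus a x) (scal t h))
    in Hd at 1 by module_eq.
  rewrite dg_plus_l, dg_scal_l in Hd.
  unfold segment.
  match goal with |- norm ?e <= _ => match type of Hd with norm ?e' <= _ =>
    replace e with e' by module_eq end end.
  eapply Rle_trans; [exact Hd|].
  apply Rmult_le_compat_r; [apply norm_ge_0|].
  now apply Rmult_le_compat_l.
Qed.

(* The affine part of [g] at [x] contributes half the antisymmetrization of
   its derivative. *)
Lemma triangle_integral_estimate (x : A) (eps d r : R) (p u v : A) :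
  0 <= eps -> remainder_le x eps d -> 4 * r < d ->
  norm (minus p x) <= r -> norm u <= r -> norm v <= r ->
  norm (minus (triangle_integral p u v)
          (scal (1 / 2) (minus (dg x u v) (dg x v u)))) <=
  16 * eps * (r * r).
Proof.
  intros Heps Hr Hd Hp Hu Hv.
  pose proof (norm_ge_0 u) as Hu0; pose proof (norm_ge_0 v) as Hv0.
  assert (Hseg : forall (y h : A) c, norm (minus y x) <= 2 * r ->
    norm h <= c * r -> c * r <= 2 * r ->
    forall t, 0 <= t <= 1 -> norm (minus (plus y (scal t h)) x) <= 4 * r).
  { intros y h c Hy Hh Hc t Ht.
    replace (minus (plus y (scal t h)) x) with
      (plus (minus y x) (scal t h)) by module_eq.
    eapply Rle_trans; [apply (norm_triangle (V := A))|].
    pose proof (norm_real_scal_le t h) as Hs.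
    rewrite Rabs_pos_eq in Hs by apply Ht.
    generalize_norms; nra. }
  assert (Hvu : norm (minus v u) <= 2 * r).
  { eapply Rle_trans; [apply (norm_minus_triangle (V := A)) |];
    generalize_norms; lra. }
  assert (Hpu : norm (minus (plus p u) x) <= 2 * r).
  { replace (minus (plus p u) x) with (plus (minus p x) u) by module_eq.
    eapply Rle_trans; [apply (norm_triangle (V := A)) |].
    generalize_norms; lra. }
  assert (E1 := segment_integral_estimate x eps d (4 * r) p u Heps Hr Hd
    (Hseg p u 1 ltac:(lra) ltac:(lra) ltac:(lra))).
  assert (E2 := segment_integral_estimate x eps d (4 * r) (plus p u)
    (minus v u) Heps Hr Hd (Hseg _ _ 2 Hpu Hvu ltac:(lra))).
  assert (E3 := segment_integral_estimate x eps d (4 * r) p v Heps Hr Hd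
    (Hseg p v 1 ltac:(lra) ltac:(lra) ltac:(lra))).
  replace (minus (plus p u) x) with (plus (minus p x) u) in E2 by module_eq.
  assert (Hg : g x (minus v u) = minus (g x v) (g x u))
    by exact (linear_minus _ v u (g_linear x)).
  assert (Hr2 : forall w, dg x w (minus v u) = minus (dg x w v) (dg x w u))
    by (intros w; exact (linear_minus _ v u (dg_linear x w))).
  assert (Hl2 : forall w, dg x (minus v u) w = minus (dg x v w) (dg x u w))
    by (intros w; unfold minus; rewrite dg_plus_l, dg_opp_l; reflexivity).
  rewrite Hg, dg_plus_l, Hl2, !Hr2 in E2.
  unfold triangle_integral.
  match type of E1 with norm ?e1 <= _ => match type of E2 with norm ?e2 <= _ =>
  match type of E3 with norm ?e3 <= _ => match goal with |- norm ?e <= _ =>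
    replace e with (minus (plus e1 e2) e3) by module_eq end end end end.
  eapply Rle_trans; [apply (norm_minus_triangle (V := B))|].
  eapply Rle_trans; [apply Rplus_le_compat_r, (norm_triangle (V := B))|].
  assert (0 <= eps * (4 * r)) by (apply Rmult_le_pos; lra).
  generalize_norms; nra.
Qed.

Definition triple_integral (T : A * A * A) : B :=
  let '(p, u, v) := T in triangle_integral p u v.

Definition triple_size (T : A * A * A) : R :=
  let '(_, u, v) := T in norm u + norm v.

Definition triple_base (T : A * A * A) : A :=
  let '(p, _, _) := T in p.

Lemma quarter_triangle (T : A * A * A) :
  { T' : A * A * A |
    norm (triple_integral T) <= 4 * norm (triple_integral T') /\
    triple_size T' <= triple_size T / 2 /\
    norm (minus (triple_base T') (triple_base T)) <= triple_size T / 2 }.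
Proof.
  destruct T as [[p u] v].
  pose (u' := scal (1 / 2) u : A); pose (v' := scal (1 / 2) v : A).
  assert (Hu : norm u' <= norm u / 2).
  { pose proof (norm_real_scal_le (1 / 2) u) as H.
    rewrite Rabs_pos_eq in H by lra; unfold u'; generalize_norms; lra. }
  assert (Hv : norm v' <= norm v / 2).
  { pose proof (norm_real_scal_le (1 / 2) v) as H.
    rewrite Rabs_pos_eq in H by lra; unfold v'; generalize_norms; lra. }
  assert (Hsum := norm_triangle (V := B)).
  assert (Hsplit := triangle_integral_split p u v); cbv zeta in Hsplit.
  fold u' v' in Hsplit.
  set (I := norm (triangle_integral p u v)).
  assert (HI : I <=
    norm (triangle_integral p u' v') +
    norm (triangle_integral (plus p u') u' v') +
    (norm (triangle_integral (plus p v') u' v') +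
     norm (triangle_integral (plus p (plus u' v')) (opp u') (opp v')))).
  { unfold I; rewrite Hsplit.
    eapply Rle_trans; [apply Hsum|].
    apply Rplus_le_compat; apply Hsum. }
  clearbody u' v'; clear Hsplit Hsum.
  destruct (Rle_lt_dec I (4 * norm (triangle_integral p u' v'))) as [H|H1].
  { exists (p, u', v'); simpl; repeat split; [exact H | lra |].
    pose proof (norm_minus_self p); generalize_norms; lra. }
  destruct (Rle_lt_dec I (4 * norm (triangle_integral (plus p u') u' v')))
    as [H|H2].
  { exists (plus p u', u', v'); simpl; repeat split; [exact H | lra |].
    assert (norm (minus (plus p u') p) = norm u') by (f_equal; module_eq).
    generalize_norms; lra. }
  destruct (Rle_lt_dec I (4 * norm (triangle_integral (plus p v') u' v')))
    as [H|H3].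
  { exists (plus p v', u', v'); simpl; repeat split; [exact H | lra |].
    assert (norm (minus (plus p v') p) = norm v') by (f_equal; module_eq).
    generalize_norms; lra. }
  exists (plus p (plus u' v'), opp u', opp v'); simpl; repeat split.
  - fold I; generalize_norms; lra.
  - pose proof (norm_opp u'); pose proof (norm_opp v'); generalize_norms; lra.
  - assert (norm (minus (plus p (plus u' v')) p) = norm (plus u' v'))
      by (f_equal; module_eq).
    pose proof (norm_triangle u' v'); generalize_norms; lra.
Qed.

Fixpoint triangle_seq (T : A * A * A) (n : nat) : A * A * A :=
  match n with
  | O => T
  | S n => proj1_sig (quarter_triangle (triangle_seq T n))
  end.

Lemma triangle_seq_integral (T : A * A * A) (n : nat) :
  norm (triple_integral T) <= 4 ^ n * norm (triple_integral (triangle_seq T n)).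
Proof.
  induction n as [|n IHn]; [simpl; lra|].
  cbn [triangle_seq].
  destruct (quarter_triangle (triangle_seq T n)) as [T' [H H']]; simpl.
  assert (0 < 4 ^ n) by (apply pow_lt; lra); nra.
Qed.

Lemma triangle_seq_size (T : A * A * A) (n : nat) :
  triple_size (triangle_seq T n) <= triple_size T * (1 / 2) ^ n.
Proof.
  induction n as [|n IHn]; [simpl; lra|].
  cbn [triangle_seq].
  destruct (quarter_triangle (triangle_seq T n)) as [T' [H' [H H'']]]; simpl.
  lra.
Qed.

Lemma triangle_seq_cauchy (T : A * A * A) (n k : nat) :
  norm (minus (triple_base (triangle_seq T (n + k)))
          (triple_base (triangle_seq T n))) <=
  triple_size T * ((1 / 2) ^ n - (1 / 2) ^ (n + k)).
Proof.
  induction k as [|k IHk].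
  - rewrite Nat.add_0_r.
    pose proof (norm_minus_self (V := A) (triple_base (triangle_seq T n))).
    generalize_norms; lra.
  - rewrite Nat.add_succ_r.
    pose proof (triangle_seq_size T (n + k)) as Hs.
    cbn [triangle_seq].
    destruct (quarter_triangle (triangle_seq T (n + k))) as [T' [H' [H'' H]]].
    cbn [proj1_sig].
    set (y := triple_base (triangle_seq T (n + k))) in *.
    set (z := triple_base (triangle_seq T n)) in *.
    replace (minus (triple_base T') z) with
      (plus (minus (triple_base T') y) (minus y z)) by module_eq.
    eapply Rle_trans; [apply (norm_triangle (V := A))|].
    rewrite <- tech_pow_Rmult; generalize_norms; lra.
Qed.

Lemma triangle_seq_limit (T : A * A * A) :
  exists x, forall n,
    norm (minus (triple_base (triangle_seq T n)) x) <=
    triple_size T * (1 / 2) ^ n.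
Proof.
  set (b := fun n => triple_base (triangle_seq T n)).
  assert (Hpow : forall n, 0 < (1 / 2) ^ n) by (intros n; apply pow_lt; lra).
  assert (HT : 0 <= triple_size T).
  { destruct T as [[p u] v]; simpl; generalize_norms; lra. }
  assert (Hb : forall n k, norm (minus (b (n + k)%nat) (b n)) <=
                           triple_size T * (1 / 2) ^ n).
  { intros n k; pose proof (triangle_seq_cauchy T n k) as H.
    pose proof (Hpow (n + k)%nat).
    eapply Rle_trans; [exact H|]; apply Rmult_le_compat_l; lra. }
  destruct (proj1 (filterlim_locally_cauchy (U := A) (F := eventually) b))
    as [x Hx].
  { intros eps.
    destruct (pow_lt_1_zero (1 / 2) ltac:(rewrite Rabs_pos_eq; lra)
      (eps / (2 * (triple_size T + 1)))) as [N HN].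
    { apply Rdiv_lt_0_compat; [apply cond_pos | lra]. }
    exists (fun n => (N <= n)%nat); split; [now exists N|].
    specialize (HN N (le_n N)); rewrite Rabs_pos_eq in HN by apply Rlt_le, Hpow.
    apply Rlt_div_r in HN; [|lra].
    intros n k Hn Hk; apply (norm_compat1 (V := A)).
    replace n with (N + (n - N))%nat by lia.
    replace k with (N + (k - N))%nat by lia.
    pose proof (Hb N (n - N)%nat) as H1; pose proof (Hb N (k - N)%nat) as H2.
    set (y := b (N + (n - N))%nat) in *; set (z := b (N + (k - N))%nat) in *.
    pose proof (norm_minus_trans (V := A) z (b N) y).
    pose proof (norm_minus_sym (V := A) (b N) y).
    specialize (Hpow N); generalize_norms; nra. }
  exists x; intros n; apply le_epsilon; intros eps Heps.
  assert (Hnear : locally x (fun y => norm (minus y x) < eps)).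
  { apply (proj2 (locally_norm_iff (V := A) x _)).
    exists eps; split; [exact Heps | intros y Hy; exact Hy]. }
  destruct (Hx _ Hnear) as [N HN].
  specialize (HN (n + N)%nat ltac:(lia)); specialize (Hb n N).
  fold (b n).
  pose proof (norm_minus_trans (V := A) (b n) (b (n + N)%nat) x).
  pose proof (norm_minus_sym (V := A) (b n) (b (n + N)%nat)).
  cbv beta in HN; generalize_norms; lra.
Qed.

(* Goursat's argument: [g] is only assumed differentiable, so Stokes' formula
   is not available. *)
Lemma goursat (p u v : A) :
  (forall x h1 h2, dg x h2 h1 = dg x h1 h2) -> triangle_integral p u v = zero.
Proof.
  intros Hsym; apply (norm_le_0_eq (V := B)).
  set (T := (p, u, v)); change (norm (triple_integral T) <= 0).
  set (S := triple_size T).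
  assert (HS : 0 <= S) by (unfold S; simpl; generalize_norms; lra).
  apply (le_0_of_le_mult_eps _ (16 * (S * S))); intros eps Heps.
  destruct (triangle_seq_limit T) as [x Hx].
  destruct (derivative_remainder x eps Heps) as [d [Hd Hr]].
  destruct (pow_lt_1_zero (1 / 2) ltac:(rewrite Rabs_pos_eq; lra)
    (d / (4 * S + 1))) as [n Hn].
  { apply Rdiv_lt_0_compat; lra. }
  specialize (Hn n (le_n n)).
  assert (Hpow : 0 < (1 / 2) ^ n) by (apply pow_lt; lra).
  rewrite Rabs_pos_eq in Hn by lra; apply Rlt_div_r in Hn; [|lra].
  pose proof (triangle_seq_integral T n) as HI.
  pose proof (triangle_seq_size T n) as Hs; fold S in Hs.
  specialize (Hx n); fold S in Hx.
  destruct (triangle_seq T n) as [[q y] z]; simpl in HI, Hs, Hx.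
  assert (Hq := triangle_integral_estimate x eps d (S * (1 / 2) ^ n) q y z
    ltac:(lra) Hr ltac:(nra) Hx ltac:(generalize_norms; lra)
    ltac:(generalize_norms; lra)).
  rewrite (Hsym x z y) in Hq.
  match type of Hq with norm ?w <= _ =>
    replace w with (triangle_integral q y z) in Hq by module_eq end.
  assert (Hpow4 : 4 ^ n * ((1 / 2) ^ n * (1 / 2) ^ n) = 1).
  { rewrite <- !Rpow_mult_distr.
    replace (4 * (1 / 2 * (1 / 2))) with 1 by field; apply pow1. }
  eapply Rle_trans; [exact HI|].
  eapply Rle_trans;
    [apply Rmult_le_compat_l; [apply pow_le; lra | exact Hq]|].
  right; transitivity
    (eps * (16 * (S * S)) * (4 ^ n * ((1 / 2) ^ n * (1 / 2) ^ n)));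
    [ring | rewrite Hpow4; ring].
Qed.

Lemma segment_integral_exact (f : A -> B) (a h : A) :
  (forall x, filterdiff f (locally x) (g x)) ->
  segment_integral a h = minus (f (plus a h)) (f a).
Proof.
  intros Hf; apply is_RInt_unique.
  assert (H := is_RInt_derive (V := B) (fun t : R => f (plus a (scal t h)))
    (segment a h) 0 1).
  replace (plus a h) with (plus a (scal 1 h)) by module_eq.
  replace (f a) with (f (plus a (scal 0 h))) by (f_equal; module_eq).
  apply H; [|intros t _; apply continuous_segment].
  intros t _; unfold is_derive.
  apply (filterdiff_ext_lin _ (fun s : R => g (plus a (scal t h)) (scal s h))).
  - apply (filterdiff_comp' (V := A)
      (fun s : R => plus a (scal s h)) f t (fun s : R => scal s h)); [|apply Hf].
    apply (filterdiff_ext_lin _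
      (fun s : R => plus (zero : A) (scal s h))); [|intros s; apply plus_zero_l].
    apply (filterdiff_plus_fct (V := A) (fun _ : R => a)
      (fun s : R => scal s h)).
    + apply (filterdiff_const (V := A) a).
    + apply (filterdiff_linear (V := A) (fun s : R => scal s h)).
      apply (is_linear_scal_l (V := A)).
  - intros s; apply (linear_scal _ (g_linear _)).
Qed.

Lemma symmetric_of_integrable :
  integrable g -> forall x h1 h2, dg x h2 h1 = dg x h1 h2.
Proof.
  intros [f Hf] x v u.
  assert (Htri : forall y z, triangle_integral x y z = zero).
  { intros y z; unfold triangle_integral.
    rewrite !(segment_integral_exact f) by exact Hf.
    replace (plus (plus x y) (minus z y)) with (plus x z) by module_eq.
    module_eq. }
  set (w := minus (dg x u v) (dg x v u)).
  enough (Hw : w = zero).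
  { replace (dg x u v) with (plus w (dg x v u)) by (unfold w; module_eq).
    rewrite Hw; apply plus_zero_l. }
  apply (norm_le_0_eq (V := B)).
  set (r := norm u + norm v).
  assert (Hr0 : 0 <= r) by (unfold r; generalize_norms; lra).
  apply (le_0_of_le_mult_eps _ (32 * (r * r))); intros eps Heps.
  destruct (derivative_remainder x eps Heps) as [d [Hd Hr]].
  set (t := d / (4 * r + 1) / 2).
  assert (Ht : 0 < t).
  { unfold t; repeat apply Rdiv_lt_0_compat; lra. }
  assert (Htr : 4 * (t * r) < d).
  { assert (t * (4 * r + 1) = d / 2) by (unfold t; field; lra). nra. }
  assert (Hn : forall y : A, norm y <= r -> norm (scal t y) <= t * r).
  { intros y Hy; pose proof (norm_real_scal_le t y) as H.
    rewrite Rabs_pos_eq in H by lra; generalize_norms; nra. }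
  assert (H := triangle_integral_estimate x eps d (t * r) x (scal t u)
    (scal t v) ltac:(lra) Hr Htr).
  rewrite Htri, !dg_scal_l,
    !(linear_scal _ (dg_linear _ _)) in H.
  assert (Hx : norm (minus x x) <= t * r).
  { eapply Rle_trans; [right; apply (norm_minus_self (V := A) x) | nra]. }
  specialize (H Hx (Hn u ltac:(unfold r; generalize_norms; lra))
    (Hn v ltac:(unfold r; generalize_norms; lra))).
  match type of H with norm ?y <= _ =>
    replace w with (scal (- (2 / (t * t))) y)
      by (unfold w; module_eq; lra) end.
  eapply Rle_trans; [apply (norm_real_scal_le (V := B))|].
  assert (Ht2 : 0 < 2 / (t * t)) by (apply Rdiv_lt_0_compat; nra).
  rewrite Rabs_Ropp, Rabs_pos_eq by lra.
  eapply Rle_trans; [apply Rmult_le_compat_l; [lra | exact H]|].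
  right; field; lra.
Qed.

Lemma integrable_of_symmetric :
  (forall x h1 h2, dg x h2 h1 = dg x h1 h2) -> integrable g.
Proof.
  intros Hsym; exists (segment_integral zero); intros x.
  split; [apply g_linear|].
  intros x' Hx'; rewrite <- (is_filter_lim_locally_unique _ _ Hx'); clear x' Hx'.
  intros eps.
  destruct (derivative_remainder x 1 Rlt_0_1) as [d [Hd Hr]].
  destruct (dg_bounded x) as [M [HM Hb]].
  apply (proj2 (locally_norm_iff (V := A) x _)).
  pose proof (cond_pos eps) as Heps.
  exists (Rmin d (eps / (1 + M))); split.
  { apply Rmin_glb_lt; [exact Hd | apply Rdiv_lt_0_compat; lra]. }
  intros y Hy.
  assert (Hyd := Rlt_le_trans _ _ _ Hy (Rmin_l _ _)).
  assert (Hye := Rlt_le_trans _ _ _ Hy (Rmin_r _ _)).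
  apply Rlt_div_r in Hye; [|lra].
  set (h := minus y x) in *.
  assert (Hf : minus (segment_integral zero y) (segment_integral zero x) =
               segment_integral x h).
  { pose proof (goursat zero x y Hsym) as H; unfold triangle_integral in H.
    rewrite plus_zero_l in H; fold h in H.
    apply minus_eq_of_plus, H. }
  change (norm (minus (minus (segment_integral zero y)
    (segment_integral zero x)) (g x h)) <= eps * norm h).
  rewrite Hf.
  assert (Hs := segment_integral_estimate x 1 d (norm h) x h Rle_0_1 Hr Hyd).
  rewrite minus_eq_zero, dg_zero_l in Hs.
  assert (Hhalf : norm (scal (1 / 2) (dg x h h)) <= M * norm h * norm h).
  { eapply Rle_trans; [apply (norm_real_scal_le (V := B))|].
    rewrite Rabs_pos_eq by lra; specialize (Hb h h).
    generalize_norms; nra. }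
  match type of Hs with _ -> norm ?e <= _ =>
    replace (minus (segment_integral x h) (g x h)) with
      (plus e (scal (1 / 2) (dg x h h))) by module_eq;
    set (e0 := e) in * end.
  eapply Rle_trans; [apply (norm_triangle (V := B))|].
  assert (He0 : norm e0 <= 1 * norm h * norm h).
  { apply Hs; intros t Ht.
    assert (Hn : norm (minus (plus x (scal t h)) x) = norm (scal t h))
      by (f_equal; module_eq).
    pose proof (norm_real_scal_le t h) as H.
    rewrite Rabs_pos_eq in H by apply Ht; generalize_norms; nra. }
  generalize_norms; nra.
Qed.

End Poincare.

(** * Transfer to D-modules *)

Section ScalarTransfer.

Variables (D : AbsRing) (iota : R -> D).
Hypothesis hD : complete_real_ring iota.
Variables A B : CompleteNormedModule D.

Let A' := restrict_scalars D iota hD A.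
Let B' := restrict_scalars D iota hD B.

Lemma is_linear_restrict (l : A -> B) :
  is_linear l -> is_linear (U := A') (V := B') l.
Proof.
  intros [H1 H2 H3]; split; [exact H1 | | exact H3].
  intros t x; exact (H2 (iota t) x).
Qed.

Lemma op_derivative_restrict (g : A -> A -> B) (x : A) (dg : A -> A -> B) :
  op_derivative g x dg -> op_derivative (A := A') (B := B') g x dg.
Proof.
  intros (H1 & H2 & H3 & H4 & H5); repeat split.
  - apply (H1 h).
  - intros t y; exact (linear_scal _ (H1 h) (iota t) y).
  - exact (linear_norm _ (H1 h)).
  - exact H2.
  - intros t h v; exact (H3 (iota t) h v).
  - exact H4.
  - exact H5.
Qed.

Lemma integrable_restrict (w : A -> A -> B) :
  (forall x, is_linear (w x)) ->
  integrable w <-> integrable (A := A') (B := B') w.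
Proof.
  intros Hw; split; intros [f Hf]; exists f; intros x; split.
  - apply is_linear_restrict, Hw.
  - exact (proj2 (Hf x)).
  - apply Hw.
  - exact (proj2 (Hf x)).
Qed.

Lemma integrable_iff_symmetric (g : A -> A -> B) (dg : A -> A -> A -> B) :
  (forall x, is_linear (g x)) ->
  (forall x, op_derivative g x (dg x)) ->
  integrable g <-> forall x h1 h2, dg x h2 h1 = dg x h1 h2.
Proof.
  intros Hg Hdg; rewrite (integrable_restrict g Hg).
  assert (Hg' : forall x : A', is_linear (U := A') (V := B') (g x))
    by (intros x; apply is_linear_restrict, Hg).
  assert (Hdg' : forall x : A', op_derivative (A := A') (B := B') g x (dg x))
    by (intros x; apply op_derivative_restrict, Hdg).
  split.
  - exact (symmetric_of_integrable (A := A') (B := B') g dg Hg' Hdg').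
  - exact (integrable_of_symmetric (A := A') (B := B') g dg Hg' Hdg').
Qed.

End ScalarTransfer.

Section OperatorDerivative.

Context {D : AbsRing} {A B : CompleteNormedModule D}.

Lemma minus_plus_plus {G : AbelianGroup} (a b c d : G) :
  minus (plus a b) (plus c d) = plus (minus a c) (minus b d).
Proof.
  unfold minus; rewrite opp_plus, <- !plus_assoc; f_equal.
  rewrite !plus_assoc; f_equal; apply plus_comm.
Qed.

Lemma is_linear_plus_fct (l1 l2 : A -> B) :
  is_linear l1 -> is_linear l2 -> is_linear (fun v => plus (l1 v) (l2 v)).
Proof.
  intros H1 H2.
  exact (is_linear_comp (fun v => (l1 v, l2 v))
    (fun p : B * B => plus (fst p) (snd p))
    (is_linear_prod l1 l2 H1 H2) is_linear_plus).
Qed.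

Lemma op_derivative_zero (x : A) :
  op_derivative (B := B) (fun _ _ => zero) x (fun _ _ => zero).
Proof.
  split; [|split; [|split; [|split]]].
  - intros _; apply (is_linear_zero (U := A) (V := B)).
  - intros _ _ _; symmetry; apply plus_zero_l.
  - intros d _ _; symmetry; apply (scal_zero_r (V := B)).
  - exists 1; split; [lra|]; intros h v.
    eapply Rle_trans; [right; apply (norm_zero (V := B))|].
    generalize_norms; nra.
  - intros eps; apply filter_forall; intros y v.
    assert (H : minus (minus (zero : B) zero) zero = zero)
      by now rewrite !minus_zero_r.
    eapply Rle_trans;
      [right; exact (eq_trans (f_equal norm H) (norm_zero (V := B)))|].
    pose proof (cond_pos eps); generalize_norms.
    apply Rmult_le_pos; [apply Rmult_le_pos|]; lra.
Qed.

Lemma op_derivative_plus (g1 g2 : A -> A -> B) (x : A) (dg1 dg2 : A -> A -> B) :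
  op_derivative g1 x dg1 -> op_derivative g2 x dg2 ->
  op_derivative (fun y v => plus (g1 y v) (g2 y v)) x
    (fun h v => plus (dg1 h v) (dg2 h v)).
Proof.
  intros (L1 & P1 & S1 & (M1 & HM1 & B1) & R1)
    (L2 & P2 & S2 & (M2 & HM2 & B2) & R2).
  split; [|split; [|split; [|split]]].
  - intros h; now apply is_linear_plus_fct.
  - intros h1 h2 v; rewrite P1, P2, <- !plus_assoc; f_equal.
    rewrite !plus_assoc; f_equal; apply plus_comm.
  - intros d h v; rewrite S1, S2; symmetry; apply (scal_distr_l (V := B)).
  - exists (M1 + M2); split; [lra|]; intros h v.
    eapply Rle_trans; [apply (norm_triangle (V := B))|].
    specialize (B1 h v); specialize (B2 h v); generalize_norms; lra.
  - intros eps.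
    generalize (filter_and _ _ (R1 (pos_div_2 eps)) (R2 (pos_div_2 eps))).
    apply filter_imp; intros y [H1 H2] v.
    rewrite !(minus_plus_plus (G := B)).
    eapply Rle_trans; [apply (norm_triangle (V := B))|].
    specialize (H1 v); specialize (H2 v); simpl in H1, H2.
    generalize_norms; lra.
Qed.

Lemma op_derivative_sum (n : nat) (g : nat -> A -> A -> B) (x : A)
    (dg : nat -> A -> A -> B) :
  (forall k, in_range n k -> op_derivative (g k) x (dg k)) ->
  op_derivative (fun y v => sum_n_m (fun k => g k y v) 1 n) x
    (fun h v => sum_n_m (fun k => dg k h v) 1 n).
Proof.
  induction n as [|n IHn]; intros H.
  - refine (eq_ind_r (fun g' => op_derivative g' x _)
      (eq_ind_r (op_derivative _ x) (op_derivative_zero x) _) _);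
      do 2 (apply functional_extensionality; intros ?);
      apply sum_n_m_zero; lia.
  - refine (eq_ind_r (fun g' => op_derivative g' x _)
      (eq_ind_r (op_derivative _ x)
        (op_derivative_plus _ (g (S n)) x _ (dg (S n)) (IHn _) _) _) _);
      try (do 2 (apply functional_extensionality; intros ?);
        apply (sum_n_Sm (G := B)); lia).
    + intros k Hk; apply H; unfold in_range in *; lia.
    + apply H; unfold in_range; lia.
Qed.

Lemma op_derivative_scal (c : A -> D) (x : A) (dc : A -> D) (l : A -> B) :
  (forall a b : D, mult a b = mult b a) ->
  filterdiff (V := AbsRing_NormedModule D) c (locally x) dc ->
  is_linear l ->
  op_derivative (fun y v => scal (c y) (l v)) x (fun h v => scal (dc h) (l v)).
Proof.
  intros Hcomm [Hdc Hc] Hl.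
  destruct (linear_norm _ Hdc) as [M [HM HdcM]].
  destruct (linear_norm _ Hl) as [N [HN HlN]].
  split; [|split; [|split; [|split]]].
  - intros h; apply (is_linear_comp l (fun w => scal (dc h) w) Hl).
    now apply is_linear_scal_r.
  - intros h1 h2 v; rewrite (linear_plus _ Hdc); apply (scal_distr_r (V := B)).
  - intros d h v; rewrite (linear_scal _ Hdc); symmetry.
    apply (scal_assoc (V := B)).
  - exists (M * N); split; [nra|]; intros h v.
    eapply Rle_trans; [apply (norm_scal (V := B))|].
    specialize (HdcM h); specialize (HlN v).
    change (abs (dc h) <= M * norm h) in HdcM.
    replace (M * N * norm h * norm v) with (M * norm h * (N * norm v)) by ring.
    apply Rmult_le_compat; auto using @abs_ge_0, @norm_ge_0.
  - intros eps.
    assert (HeN : 0 < eps / N) by (apply Rdiv_lt_0_compat; [apply cond_pos|lra]).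
    generalize (Hc x (fun P HP => HP) (mkposreal _ HeN)).
    apply filter_imp; intros y Hy v; simpl in Hy.
    rewrite <- !(scal_minus_distr_r (V := B)).
    eapply Rle_trans; [apply (norm_scal (V := B))|].
    specialize (HlN v).
    replace (eps * norm (minus y x) * norm v) with
      (eps / N * norm (minus y x) * (N * norm v)) by (field; lra).
    apply Rmult_le_compat; auto using @abs_ge_0, @norm_ge_0.
Qed.

End OperatorDerivative.

Section StandardComponents.

Context {D : AbsRing} {B : CompleteNormedModule D}.

Lemma is_linear_tensor_act (mul : B -> B -> B) (a b : B) (f : B -> B) :
  banach_algebra mul -> is_linear f -> is_linear (tensor_act mul a b f).
Proof.
  intros hB Hf; unfold tensor_act; split.
  - intros x y.
    now rewrite (linear_plus _ Hf), (alg_plus_r hB), (alg_plus_l hB).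
  - intros d x.
    now rewrite (linear_scal _ Hf), (alg_scal_r hB), (alg_scal_l hB).
  - destruct (linear_norm _ Hf) as [M [HM H]].
    exists (norm a * M * norm b + 1).
    pose proof (norm_ge_0 a); pose proof (norm_ge_0 b).
    split; [assert (0 <= norm a * M) by nra; nra|]; intros x.
    eapply Rle_trans; [apply (alg_norm hB)|].
    eapply Rle_trans;
      [apply Rmult_le_compat_r; [apply norm_ge_0 | apply (alg_norm hB)]|].
    assert (norm a * norm (f x) <= norm a * (M * norm x))
      by (apply Rmult_le_compat_l; auto).
    pose proof (norm_ge_0 x); nra.
Qed.

Lemma op_derivative_std_expansion {A : CompleteNormedModule D}
    (mul : B -> B -> B) (n m : nat) (e : nat -> B) (F : nat -> B -> B)
    (G : A -> B) (gc : nat -> nat -> nat -> A -> D)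
    (dgc : nat -> nat -> nat -> A -> D) (x : A) :
  (forall a b : D, mult a b = mult b a) ->
  banach_algebra mul ->
  (forall k, in_range m k -> is_linear (F k)) ->
  is_linear G ->
  (forall k i j, in_range m k -> in_range n i -> in_range n j ->
     filterdiff (V := AbsRing_NormedModule D)
       (gc k i j) (locally x) (dgc k i j)) ->
  op_derivative
    (fun y v => std_expansion mul n m e F (fun k i j => gc k i j y) (G v)) x
    (fun h v => std_expansion mul n m e F (fun k i j => dgc k i j h) (G v)).
Proof.
  intros Hcomm hB HF HG Hgc; unfold std_expansion.
  apply op_derivative_sum; intros k Hk.
  apply op_derivative_sum; intros i Hi.
  apply op_derivative_sum; intros j Hj.
  apply op_derivative_scal; [exact Hcomm | now apply Hgc |].
  apply (is_linear_comp G (tensor_act mul (e i) (e j) (F k)) HG).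
  apply is_linear_tensor_act; [exact hB | now apply HF].
Qed.

End StandardComponents.

Theorem theorem6p5p4
  (D : AbsRing) (iota : R -> D) (hD : complete_real_ring iota)
  (A B : CompleteNormedModule D)
  (mul : B -> B -> B) (hB : banach_algebra mul)
  (n : nat) (e : nat -> B) (he : is_basis n e)
  (m : nat) (F : nat -> B -> B) (hF : tensor_basis mul m F)
  (G : A -> B) (hG : is_linear G) (hGmax : maximal_rank G)
  (g : A -> A -> B)
  (hglin : forall x : A, is_linear (g x))
  (hgdiff : op_differentiable g)
  (hker : forall x h : A, G h = zero -> g x h = zero)
  (gc : nat -> nat -> nat -> A -> D)
  (dgc : nat -> nat -> nat -> A -> A -> D)
  (hgc : forall k i j : nat,
     in_range m k -> in_range n i -> in_range n j ->
     forall x : A,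
       filterdiff (V := AbsRing_NormedModule D)
         (gc k i j) (locally x) (dgc k i j x))
  (hexp : forall x h : A,
     g x h = std_expansion mul n m e F (fun k i j => gc k i j x) (G h)) :
  integrable
    (fun x h : A =>
       std_expansion mul n m e F (fun k i j => gc k i j x) (G h))
  <->
  (forall x h1 h2 : A,
     std_expansion mul n m e F (fun k i j => dgc k i j x h2) (G h1) =
     std_expansion mul n m e F (fun k i j => dgc k i j x h1) (G h2)).
Proof.
  rewrite (integrable_iff_symmetric D iota hD A B _
    (fun x h v =>
       std_expansion mul n m e F (fun k i j => dgc k i j x h) (G v))).
  - reflexivity.
  - intros x; exact (is_linear_ext _ _ (hexp x) (hglin x)).
  - intros x.
    apply (op_derivative_std_expansion mul n m e F G gc
      (fun k i j => dgc k i j x) x (crr_comm hD) hB (proj1 hF) hG).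
    intros k i j Hk Hi Hj; now apply hgc.
Qed.
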